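(* There exists a $\mathrm{GDD}(4,5,14\cdot 720+11\cdot 720)$ of type $720^{14}(11\cdot 720)^1$.
   Context: A group divisible design $\mathrm{GDD}(t,k,m)$ of type $g_1^{n_1} g_2^{n_2}\cdots g_r^{n_r}$, where $t \ge 2$ and $m=\sum_{i=1}^r n_i g_i$, is a triple $(X,G,B)$ such that $X$ is a set of $m$ points; $G$ is a partition of $X$ into $n=\sum_{i=1}^r n_i$ groups, of which $n_i$ have exactly $g_i$ points, $1\le i\le r$; $B$ is a set of $k$-subsets of $X$ (blocks); each block contains at most one point from each group; and each $t$-subset of $X$ which contains at most one point from each group is contained in exactly one block of $B$. *)

(* Defs.v *)
From mathcomp Require Import all_boot.

Set Implicit Arguments.
Unset Strict Implicit.
Unset Printing Implicit Defensive.

(* The type g_1^{n_1} ... g_r^{n_r} is the sequence of the pairs (g_i, n_i). *)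
Definition gdd_type := seq (nat * nat).

Definition type_points (ty : gdd_type) : nat := \sum_(gn <- ty) gn.2 * gn.1.

Definition type_group_sizes (ty : gdd_type) : seq nat :=
  flatten [seq nseq gn.2 gn.1 | gn <- ty].

(* G has type ty when, counted with multiplicity, the sizes of the groups are
   g_1 (n_1 times), ..., g_r (n_r times); in particular #|G| = \sum_i n_i. *)
Definition has_type (X : finType) (G : {set {set X}}) (ty : gdd_type) : bool :=
  perm_eq [seq #|A| | A : {set X} in G] (type_group_sizes ty).

Definition transverse (X : finType) (G : {set {set X}}) (S : {set X}) : Prop :=
  forall A : {set X}, A \in G -> #|S :&: A| <= 1.

Record is_gdd (t k m : nat) (ty : gdd_type)
    (X : finType) (G B : {set {set X}}) : Prop := IsGDD {
  gdd_strength : 2 <= t;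
  gdd_order : m = type_points ty;
  gdd_points : #|X| = m;
  gdd_partition : partition G [set: X];
  gdd_has_type : has_type G ty;
  gdd_block_size : forall b : {set X}, b \in B -> #|b| = k;
  gdd_block_transverse : forall b : {set X}, b \in B -> transverse G b;
  gdd_balance : forall T : {set X}, #|T| = t -> transverse G T ->
    exists! b : {set X}, b \in B /\ T \subset b
}.

(* Main.v *)
Require Import Defs.
From mathcomp Require Import all_boot all_algebra.

Set Implicit Arguments.
Unset Strict Implicit.
Unset Printing Implicit Defensive.

Import GRing.Theory.

(** The large group has 11 * 720 points, exactly the number needed for every
    block to have one point in it and four in distinct small groups.  Such a
    block projects to a 4-subset Q of the set V of the 14 small groups.  The idea
    is to let each point l of the large group stand for a Steiner quadruple
    system S l = S(3,4,14) on V, consisting of the projections of the blocks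
    through l.  So let a family (S l), l in J, of Steiner systems cover
    every 4-subset of V the same number of times, namely 720 times.  Give the
    small group of v the points (v, x) with x in Z_720, number by s in Z_720
    the systems of the family that contain Q, and take as blocks the sets made
    of the points (v, x_v) with v in Q and of the system of number
    \sum_(v in Q) x_v among those containing Q.  Four points in small groups
    determine the number, hence the system; three points in small groups and a
    system l determine Q, because S l is a Steiner system, and then the last
    x_v, because the sum is known ([gdd_of_steiner_family]).

    It remains to find 7920 quadruple systems on 14 points that cover every
    4-subset 720 times, repetitions being allowed.  Let the group of the 55 maps
    x |-> a x + b, with a a nonzero square, act on the 14 points of
    Z_11 + {11, 12, 13}, fixing the last three.  It has 19 orbits on the
    4-subsets: 18 regular ones, and the one of the 11 sets {x, 11, 12, 13}.  The
    number of group elements g with Q in g S is the order of the stabiliser of Q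
    times the number of blocks of S in the orbit of Q.  So the 55 images of S
    cover every 4-subset 5 times as soon as S has 5 blocks in each regular orbit:
    in the last orbit, the stabilisers have order 5 and S has exactly one block,
    the one through 11, 12, 13.  The system [sqs] has this property
    ([cover_designs]); taking every image 144 times gives 144 * 55 = 7920 systems
    and 144 * 5 = 720 covers. *)

(** * Gluing a family of Steiner systems into a group divisible design *)

Definition steiner (V : finType) (k : nat) (S : {set {set V}}) : Prop :=
  (forall Q, Q \in S -> #|Q| = k) /\
  (forall A : {set V}, #|A|.+1 = k -> exists! Q, Q \in S /\ A \subset Q).

Lemma labelling_exists (J K : finType) (s0 : K) (P : {set J}) :
  #|P| = #|K| ->
  exists c : J -> K, forall s, exists! l, l \in P /\ c l = s.
Proof.
move=> cardPK; exists (fun l => nth s0 (enum K) (index l (enum P))) => s.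
have idx_lt l : l \in P -> index l (enum P) < size (enum K).
  by move=> Pl; rewrite -[size _]cardE -cardPK cardE index_mem mem_enum.
have s_lt : index s (enum K) < size (enum P).
  by rewrite -[size (enum P)]cardE cardPK cardE index_mem mem_enum.
have [l0 _] : exists l0, l0 \in P.
  by apply/card_gt0P; rewrite cardPK; apply/card_gt0P; exists s0.
exists (nth l0 (enum P) (index s (enum K))); split.
  split; first by rewrite -mem_enum mem_nth.
  by rewrite index_uniq ?enum_uniq // nth_index ?mem_enum.
move=> l [Pl <-]; rewrite index_uniq ?enum_uniq ?idx_lt //.
by rewrite nth_index ?mem_enum.
Qed.

Lemma setU1_of_card (X : finType) (T b : {set X}) :
  T \subset b -> #|b| = #|T|.+1 -> exists2 p, p \notin T & b = p |: T.
Proof.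
move=> Tb cardb; have /cards1P[p bDT] : #|b :\: T| == 1.
  by rewrite cardsD (setIidPr Tb) cardb subSnn.
have : p \in b :\: T by rewrite bDT set11.
rewrite inE => /andP[pT pb]; exists p => //.
by rewrite -[LHS](setID b T) (setIidPr Tb) bDT setUC.
Qed.

Section Glue.

Variables (V J : finType) (K : finZmodType).

Definition point : finType := (V * K + J)%type.

(** The group containing p: that of v for [Some v], the large one for [None].
    In this form transversality is the injectivity of a function. *)
Definition key (p : point) : option V := if p is inl vx then Some vx.1 else None.

Definition shift (p : point) : K := if p is inl vx then vx.2 else 0%R.

Definition groups : {set {set point}} := preim_partition key [set: point].

(** The projection of a transverse set to V. *)
Definition supp (T : {set point}) : {set V} := [set v | Some v \in key @: T].

Definition weight (T : {set point}) : K := (\sum_(p in T) shift p)%R.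

Lemma groupsE : groups = [set [set p | key p == o] | o in codom key].
Proof.
apply/setP=> A; apply/imsetP/imsetP => [[p _ ->]|[o /codomP[p ->] ->]].
  exists (key p); first exact: codom_f.
  by apply/setP=> p'; rewrite !inE eq_sym.
by exists p => //; apply/setP=> p'; rewrite !inE eq_sym.
Qed.

Lemma transverseP (T : {set point}) :
  transverse groups T <-> {in T &, injective key}.
Proof.
split=> [trT p p' Tp Tp' kpp'|injT A].
  have /trT/card_le1_eqP : [set x | key x == key p] \in groups.
    by rewrite groupsE; apply: imset_f; apply: codom_f.
  by apply; rewrite !inE ?Tp ?Tp' -?kpp' eqxx.
rewrite groupsE => /imsetP[o _ ->]; apply/card_le1_eqP => p p'.
rewrite !inE => /andP[Tp /eqP kp] /andP[Tp' /eqP kp'].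
by apply: injT; rewrite // kp kp'.
Qed.

Lemma transverse_setU1 p (T : {set point}) :
  {in T &, injective key} -> key p \notin key @: T ->
  {in p |: T &, injective key}.
Proof.
move=> injT pT x y; rewrite !inE.
case/predU1P=> [->|Tx] /predU1P[->|Ty] // kxy; last exact: injT.
  by case/negP: pT; rewrite kxy imset_f.
by case/negP: pT; rewrite -kxy imset_f.
Qed.

Lemma key_notin_setU1 p (T : {set point}) :
  {in p |: T &, injective key} -> p \notin T -> key p \notin key @: T.
Proof.
move=> inj pT; apply: contra pT => /imsetP[p' Tp' kpp'].
by rewrite (inj p p') // !inE ?eqxx ?Tp' ?orbT.
Qed.

Lemma card_supp (T : {set point}) :
  {in T &, injective key} -> #|T| = (None \in key @: T) + #|supp T|.
Proof.
move=> injT; rewrite -(card_in_imset injT) (cardsD1 None); congr (_ + _).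
have SomeI : injective (@Some V) by move=> ? ? [].
rewrite -(card_imset (mem (supp T)) SomeI).
apply: eq_card => -[v|]; rewrite !inE /=; first by rewrite mem_imset ?inE.
by apply/esym/negbTE/imsetP=> -[].
Qed.

Lemma supp_setU1_inr l (T : {set point}) : supp (inr l |: T) = supp T.
Proof. by apply/setP=> v; rewrite !inE imsetU1 !inE. Qed.

Lemma supp_setU1_inl v x (T : {set point}) :
  supp (inl (v, x) |: T) = v |: supp T.
Proof. by apply/setP=> u; rewrite !inE imsetU1 !inE. Qed.

Lemma weight_setU1 p (T : {set point}) :
  p \notin T -> weight (p |: T) = (shift p + weight T)%R.
Proof. exact: big_setU1. Qed.

Lemma None_key (T : {set point}) :
  reflect (exists l, inr l \in T) (None \in key @: T).
Proof.
apply: (iffP imsetP) => [[[[v x]|l] Tp] // _|[l Tl]]; first by exists l.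
by exists (inr l).
Qed.

Variables (k : nat) (S : J -> {set {set V}}) (c : {set V} -> J -> K).

(** [c Q l] is the number of the system [S l] among those containing Q. *)
Definition blocks : {set {set point}} :=
  [set b : {set point} | [&& dinjectiveb key b, #|b| == k.+1 &
    [exists l, [&& inr l \in b, supp b \in S l & weight b == c (supp b) l]]]].

Hypothesis kgt1 : 1 < k.
Hypothesis steinerS : forall l, steiner k (S l).
Hypothesis labelc : forall Q : {set V}, #|Q| = k ->
  forall s, exists! l, Q \in S l /\ c Q l = s.

Lemma blocksP (b : {set point}) :
  reflect ([/\ {in b &, injective key}, #|b| = k.+1 &
    exists l, [/\ inr l \in b, supp b \in S l & weight b = c (supp b) l]])
    (b \in blocks).
Proof.
rewrite inE.
apply: (iffP and3P) => [[/dinjectiveP inj /eqP card_b /existsP[l]]|].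
  by case/and3P=> lb bS /eqP wb; split=> //; exists l.
case=> inj card_b [l [lb bS wb]]; split; [exact/dinjectiveP|exact/eqP|].
by apply/existsP; exists l; rewrite lb bS wb eqxx.
Qed.

(** A block through T adds to it a point of the large group, which leaves [supp]
    and [weight] unchanged; so the labelling determines this point. *)
Lemma blocks_balance_small (T : {set point}) :
  {in T &, injective key} -> #|T| = k -> None \notin key @: T ->
  exists! b, b \in blocks /\ T \subset b.
Proof.
move=> injT cardT NT.
have cardQ : #|supp T| = k by rewrite -cardT card_supp // (negPf NT).
have inrT l : inr l \notin T.
  by apply: contra NT => Tl; apply/None_key; exists l.
have [l [[TS cT] uniq_l]] := labelc cardQ (weight T).
exists (inr l |: T); split.
  split; last exact: subsetUr.
  apply/blocksP; split; first exact: transverse_setU1.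
    by rewrite cardsU1 inrT cardT.
  exists l; rewrite supp_setU1_inr weight_setU1 // add0r cT; split=> //.
  by rewrite !inE eqxx.
move=> b [/blocksP[inj_b card_b [l' [l'b bS wb]]] Tb].
have [|p pT bE] := setU1_of_card Tb; first by rewrite card_b cardT.
have pE : p = inr l'.
  by move: l'b; rewrite bE !inE (negPf (inrT l')) orbF => /eqP.
move: bS wb; rewrite bE pE supp_setU1_inr weight_setU1 // add0r => TS' wT.
by rewrite (uniq_l l').
Qed.

(** With l in T the system is fixed; it extends [supp T] by one v only, and the
    coordinate over v is then what [weight T] lacks to reach the label of l. *)
Lemma blocks_balance_large (T : {set point}) :
  {in T &, injective key} -> #|T| = k -> None \in key @: T ->
  exists! b, b \in blocks /\ T \subset b.
Proof.
move=> injT cardT NT.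
have cardA : #|supp T|.+1 = k by rewrite -cardT card_supp // NT.
have /None_key[l Tl] := NT.
have [sizeS /(_ _ cardA)[Q [[QS AQ] uniqQ]]] := steinerS l.
have [|v vA QE] := setU1_of_card AQ; first by rewrite (sizeS Q) ?cardA.
have vT x : key (inl (v, x)) \notin key @: T.
  by apply: contra vA => kT; rewrite inE.
pose x := (c Q l - weight T)%R.
have pT : inl (v, x) \notin T by apply: contra (vT x); apply: imset_f.
exists (inl (v, x) |: T); split.
  split; last exact: subsetUr.
  apply/blocksP; split; first exact: transverse_setU1.
    by rewrite cardsU1 pT cardT.
  exists l; rewrite supp_setU1_inl weight_setU1 //= -QE subrK; split=> //.
  by rewrite !inE Tl.
move=> b [/blocksP[inj_b card_b [l' [l'b bS wb]]] Tb].
have [ll'] : inr l' = inr l :> point.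
  by apply: inj_b; rewrite // (subsetP Tb).
rewrite {l'}ll' in l'b bS wb.
have [|p p'T bE] := setU1_of_card Tb; first by rewrite card_b cardT.
have kpT : key p \notin key @: T by apply: key_notin_setU1 => //; rewrite -bE.
case: p => [[v' x']|l'] in p'T bE kpT *; last by rewrite NT in kpT.
move: bS wb; rewrite bE supp_setU1_inl weight_setU1 //= => bS wb.
have QE' : Q = v' |: supp T by apply: uniqQ; split=> //; apply: subsetUr.
have vv' : v' = v.
  have: v' \in Q by rewrite QE' setU11.
  by rewrite QE !inE => /predU1P[// | v'T]; case/negP: kpT.
by rewrite /x QE' -wb addrK vv'.
Qed.

Lemma has_type_groups :
  0 < #|J| -> has_type groups [:: (#|K|, #|V|); (#|J|, 1)].
Proof.
move=> J0; have [l _] := card_gt0P J0.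
have keyP o : exists p, key p = o.
  by case: o => [v|]; [exists (inl (v, 0%R))|exists (inr l)].
pose fibre o := [set p | key p == o].
have fibre_inj : injective fibre.
  move=> o o' /setP E; have [p kp] := keyP o.
  by move: (E p); rewrite !inE kp eqxx => /esym/eqP.
have SomeI : injective (@Some V) by move=> ? ? [].
have enumG :
    perm_eq (enum groups) [seq fibre o | o <- None :: map some (enum V)].
  apply: uniq_perm => [||A]; first exact: enum_uniq.
    rewrite (map_inj_uniq fibre_inj) /= (map_inj_uniq SomeI) enum_uniq andbT.
    by apply/mapP=> -[].
  rewrite mem_enum groupsE; apply/imsetP/mapP => [[o _ ->]|[o _ ->]].
    exists o => //; case: o => // v.
    by rewrite inE mem_map ?mem_enum.
  by exists o => //; have [p <-] := keyP o; apply: codom_f.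
rewrite /has_type /image_mem (permPl (perm_map _ enumG)) /= -!map_comp perm_sym.
have -> : type_group_sizes [:: (#|K|, #|V|); (#|J|, 1)]
  = rcons (nseq #|V| #|K|) #|J|.
  by rewrite /type_group_sizes /= -cats1.
rewrite perm_rcons.
have -> : #|fibre None| = #|J|.
  have inrI : injective (inr : J -> point) by move=> ? ? [].
  rewrite -cardsT -(card_imset _ inrI); apply: eq_card => -[[v x]|j]; rewrite inE.
    by apply/esym/imsetP=> -[].
  by apply/esym; apply: imset_f; rewrite inE.
have card_fibre v : #|fibre (Some v)| = #|K|.
  have inlI : injective (fun x : K => inl (v, x) : point) by move=> ? ? [].
  rewrite -cardsT -(card_imset _ inlI); apply: eq_card => -[[u x]|j]; rewrite inE.
    apply/eqP/imsetP => [[->]|[y _ [-> _]] //]; by exists x.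
  by apply/esym/imsetP=> -[].
have -> : nseq #|V| #|K| = [seq #|K| | v <- enum V].
  by rewrite cardE; elim: (enum V) => //= v s ->.
rewrite perm_cons; apply/permP => P; congr (count P _).
by rewrite -enumT; apply: eq_map => v; rewrite /= card_fibre.
Qed.

Lemma is_gdd_blocks :
  0 < #|J| ->
  is_gdd k k.+1 (#|V| * #|K| + #|J|) [:: (#|K|, #|V|); (#|J|, 1)] groups blocks.
Proof.
move=> J0; split=> //.
- by rewrite /type_points !big_cons big_nil mul1n addn0.
- by rewrite card_sum card_prod.
- exact: preim_partitionP.
- exact: has_type_groups.
- by move=> b /blocksP[].
- by move=> b /blocksP[inj _ _]; apply/transverseP.
move=> T cardT /transverseP injT.
by case: (boolP (None \in key @: T)) => NT;
  [apply: blocks_balance_large|apply: blocks_balance_small].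
Qed.

End Glue.

Theorem gdd_of_steiner_family (V J : finType) (K : finZmodType) (k : nat)
    (S : J -> {set {set V}}) :
  1 < k -> 0 < #|J| -> (forall l, steiner k (S l)) ->
  (forall Q : {set V}, #|Q| = k -> #|[set l | Q \in S l]| = #|K|) ->
  exists G B : {set {set point V J K}},
    is_gdd k k.+1 (#|V| * #|K| + #|J|) [:: (#|K|, #|V|); (#|J|, 1)] G B.
Proof.
move=> kgt1 J0 steinerS coverS.
have /fin_all_exists[c labelc] : forall Q : {set V}, exists c : J -> K,
    #|Q| = k -> forall s, exists! l, Q \in S l /\ c l = s.
  move=> Q; have [card_Q|] := eqVneq #|Q| k; last first.
    by move=> neq_Q; exists (fun=> 0%R) => /eqP; rewrite (negPf neq_Q).
  have [c cP] := labelling_exists 0%R (coverS Q card_Q).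
  exists c => _ s; have [l [[Ql cl] uniq_l]] := cP s; rewrite inE in Ql.
  by exists l; split=> // l' [Ql' cl']; apply: uniq_l; rewrite inE.
exists (groups V J K), (blocks k S c); exact: is_gdd_blocks.
Qed.



(** * Counting with characteristic sequences *)

(** Decides that every Boolean sequence m of length n with k entries [true] is
    related entrywise by r to exactly lam elements of L.  On characteristic
    sequences, [implb] is inclusion and [eqb] is equality.  All the m are
    treated at once, along the tree of their prefixes, keeping at each node only
    the elements of L whose own prefix is related to it; this makes the counts
    below cheap to compute. *)
Fixpoint balanced (r : rel bool) (lam k n : nat) (L : seq bitseq) : bool :=
  match n, k with
  | 0, 0 => size L == lam
  | 0, _.+1 => true
  | n'.+1, _ =>
    balanced r lam k n' [seq behead s | s <- L & r false (head false s)] &&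
    (if k is k'.+1 then
       balanced r lam k' n' [seq behead s | s <- L & r true (head false s)]
     else true)
  end.

Lemma balancedP r lam k n L : all (fun s => size s == n) L ->
  balanced r lam k n L ->
  forall m : bitseq, size m = n -> count id m = k -> count (all2 r m) L = lam.
Proof.
elim: n k L => [|n IHn] k L sizeL.
  case: k => [/eqP <-|k _] [] // _ _; rewrite -[RHS]count_predT.
  by apply: eq_in_count => s /(allP sizeL); case: s.
move=> /andP[balF balT] [] // b m [size_m] count_m.
have step k' : balanced r lam k' n [seq behead s | s <- L & r b (head false s)] ->
    count id m = k' -> count (all2 r (b :: m)) L = lam.
  move=> bal_b count_m'; rewrite -(IHn _ _ _ bal_b m) //; last first.
    apply/allP=> _ /mapP[s + ->]; rewrite mem_filter => /andP[_ Ls].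
    by rewrite size_behead (eqP (allP sizeL s Ls)).
  rewrite count_map count_filter; apply: eq_in_count => s /(allP sizeL).
  by case: s => //= x s _; rewrite andbC.
case: b count_m step => /= [|count_m] step; last exact: step balF count_m.
by case: k balT {balF} step => // k balT [count_m] /(_ k balT); apply.
Qed.

Lemma all2_map (T : Type) (r : rel bool) (f g : T -> bool) s :
  all2 r [seq f x | x <- s] [seq g x | x <- s] = all (fun x => r (f x) (g x)) s.
Proof. by elim: s => //= x s ->. Qed.

Definition char_set n (A : {set 'I_n}) : bitseq := [seq x \in A | x <- enum 'I_n].

Lemma size_char_set n (A : {set 'I_n}) : size (char_set A) = n.
Proof. by rewrite size_map size_enum_ord. Qed.

Lemma count_char_set n (A : {set 'I_n}) : count id (char_set A) = #|A|.
Proof. by rewrite count_map cardE enumT -size_filter. Qed.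

Lemma all2_implb_char_set n (A B : {set 'I_n}) :
  all2 implb (char_set A) (char_set B) = (A \subset B).
Proof.
rewrite all2_map; apply/allP/subsetP => [sAB x|sAB x _]; last exact/implyP/sAB.
by apply/implyP/sAB; rewrite mem_enum.
Qed.

Lemma all2_eqb_char_set n (A B : {set 'I_n}) :
  all2 eqb (char_set A) (char_set B) = (B == A).
Proof.
rewrite all2_map; apply/allP/eqP => [sAB|-> x _]; last exact: eqxx.
by apply/setP=> x; apply/esym/eqP/sAB; rewrite mem_enum.
Qed.

Lemma balanced_char_set r lam k n (L : seq {set 'I_n}) :
  balanced r lam k n [seq char_set Q | Q <- L] ->
  forall A : {set 'I_n}, #|A| = k ->
    count (fun Q => all2 r (char_set A) (char_set Q)) L = lam.
Proof.
move=> bal A card_A; have sizeL : all (fun s => size s == n) (map (@char_set n) L).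
  by apply/allP=> _ /mapP[Q _ ->]; rewrite size_char_set.
by rewrite -(balancedP sizeL bal (size_char_set A)) ?count_char_set // count_map.
Qed.

Lemma steiner_count (V : finType) k (L : seq {set V}) :
  all (fun Q : {set V} => #|Q| == k) L ->
  (forall A : {set V}, #|A|.+1 = k ->
     count (fun Q : {set V} => A \subset Q) L = 1) ->
  steiner k [set Q in L].
Proof.
move=> cardL countL; split=> [Q|A /countL].
  by rewrite inE => /(allP cardL)/eqP.
rewrite -size_filter; case def_L: [seq Q <- L | _] => [|Q [|]] // _.
have inL Q' : Q' \in L /\ A \subset Q' <-> Q' = Q.
  split=> [[LQ' AQ']|->].
    by apply/eqP; rewrite -mem_seq1 -def_L mem_filter AQ'.
  by have := mem_head Q [::]; rewrite -def_L mem_filter => /andP[].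
by exists Q; split=> [|Q']; rewrite inE; [apply/inL|move/inL].
Qed.

Lemma card_index_flatten (T : eqType) (Ls : seq (seq T)) x :
  (forall L, L \in Ls -> count_mem x L <= 1) ->
  #|[set j : 'I_(size Ls) | x \in nth [::] Ls j]| = count_mem x (flatten Ls).
Proof.
move=> le1; rewrite -sum1dep_card count_flatten sumnE big_map.
rewrite -(big_mkord (fun j => x \in nth [::] Ls j) (fun=> 1)).
rewrite -(big_nth [::] (fun L => x \in L) (fun=> 1)) big_mkcond.
apply: eq_big_seq => L /le1; rewrite -has_pred1 has_count.
by case: (count_mem x L) => [|[|]].
Qed.

(** * Fifty-five quadruple systems on 14 points *)

(** A Steiner quadruple system S(3,4,14) invariant, up to relabelling, under a
    permutation with two cycles of length 7; the relabelling is chosen so that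
    there are 5 blocks in each regular orbit of the group of the maps [aff a b],
    for a a nonzero square modulo 11. *)
Definition sqs : seq (seq nat) := [::
    [:: 0; 1; 2; 13]; [:: 0; 1; 3; 12]; [:: 0; 1; 4; 9]; [:: 0; 1; 5; 7];
    [:: 0; 1; 6; 11]; [:: 0; 1; 8; 10]; [:: 0; 2; 3; 9]; [:: 0; 2; 4; 6];
    [:: 0; 2; 5; 10]; [:: 0; 2; 7; 11]; [:: 0; 2; 8; 12]; [:: 0; 3; 4; 7];
    [:: 0; 3; 5; 8]; [:: 0; 3; 6; 13]; [:: 0; 3; 10; 11]; [:: 0; 4; 5; 11];
    [:: 0; 4; 8; 13]; [:: 0; 4; 10; 12]; [:: 0; 5; 6; 12]; [:: 0; 5; 9; 13];
    [:: 0; 6; 7; 8]; [:: 0; 6; 9; 10]; [:: 0; 7; 9; 12]; [:: 0; 7; 10; 13];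
    [:: 0; 8; 9; 11]; [:: 0; 11; 12; 13]; [:: 1; 2; 3; 4]; [:: 1; 2; 5; 8];
    [:: 1; 2; 6; 9]; [:: 1; 2; 7; 12]; [:: 1; 2; 10; 11]; [:: 1; 3; 5; 6];
    [:: 1; 3; 7; 9]; [:: 1; 3; 8; 11]; [:: 1; 3; 10; 13]; [:: 1; 4; 5; 10];
    [:: 1; 4; 6; 13]; [:: 1; 4; 7; 8]; [:: 1; 4; 11; 12]; [:: 1; 5; 9; 11];
    [:: 1; 5; 12; 13]; [:: 1; 6; 7; 10]; [:: 1; 6; 8; 12]; [:: 1; 7; 11; 13];
    [:: 1; 8; 9; 13]; [:: 1; 9; 10; 12]; [:: 2; 3; 5; 12]; [:: 2; 3; 6; 7];
    [:: 2; 3; 8; 10]; [:: 2; 3; 11; 13]; [:: 2; 4; 5; 9]; [:: 2; 4; 7; 10];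
    [:: 2; 4; 8; 11]; [:: 2; 4; 12; 13]; [:: 2; 5; 6; 11]; [:: 2; 5; 7; 13];
    [:: 2; 6; 8; 13]; [:: 2; 6; 10; 12]; [:: 2; 7; 8; 9]; [:: 2; 9; 10; 13];
    [:: 2; 9; 11; 12]; [:: 3; 4; 5; 13]; [:: 3; 4; 6; 10]; [:: 3; 4; 8; 12];
    [:: 3; 4; 9; 11]; [:: 3; 5; 7; 11]; [:: 3; 5; 9; 10]; [:: 3; 6; 8; 9];
    [:: 3; 6; 11; 12]; [:: 3; 7; 8; 13]; [:: 3; 7; 10; 12]; [:: 3; 9; 12; 13];
    [:: 4; 5; 6; 8]; [:: 4; 5; 7; 12]; [:: 4; 6; 7; 11]; [:: 4; 6; 9; 12];
    [:: 4; 7; 9; 13]; [:: 4; 8; 9; 10]; [:: 4; 10; 11; 13]; [:: 5; 6; 7; 9];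
    [:: 5; 6; 10; 13]; [:: 5; 7; 8; 10]; [:: 5; 8; 9; 12]; [:: 5; 8; 11; 13];
    [:: 5; 10; 11; 12]; [:: 6; 7; 12; 13]; [:: 6; 8; 10; 11]; [:: 6; 9; 11; 13];
    [:: 7; 8; 11; 12]; [:: 7; 9; 10; 11]; [:: 8; 10; 12; 13]].

Definition aff (a b x : nat) : nat := if x < 11 then (a * x + b) %% 11 else x.

Definition images : seq (seq (seq nat)) :=
  (* 1, 3, 9, 5, 4 are the nonzero squares modulo 11. *)
  [seq [seq [seq aff a b x | x <- Q] | Q <- sqs] |
     a <- [:: 1; 3; 9; 5; 4], b <- iota 0 11].

Definition char_seq (Q : seq nat) : bitseq := [seq x \in Q | x <- iota 0 14].

Lemma images_size :
  all (all (fun Q => count id (char_seq Q) == 4)) images.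
Proof. by vm_compute. Qed.

Lemma images_steiner :
  all (fun L => balanced implb 1 3 14 [seq char_seq Q | Q <- L]) images.
Proof. by vm_compute. Qed.

Lemma images_balanced :
  balanced eqb 5 4 14 [seq char_seq Q | Q <- flatten images].
Proof. by vm_compute. Qed.

Definition set_of_seq (Q : seq nat) : {set 'I_14} := [set x | val x \in Q].

Lemma char_set_set_of_seq Q : char_set (set_of_seq Q) = char_seq Q.
Proof.
rewrite /char_seq -val_enum_ord -map_comp.
by apply: eq_map => x; rewrite inE.
Qed.

Definition designs : seq (seq {set 'I_14}) :=
  [seq [seq set_of_seq Q | Q <- L] | L <- images].

Lemma count_designs L (A : {set 'I_14}) : L \in designs ->
  #|A| = 3 -> count (fun Q : {set 'I_14} => A \subset Q) L = 1.
Proof.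
case/mapP=> L' tL' -> card_A.
under eq_count do rewrite -all2_implb_char_set.
apply: balanced_char_set card_A; rewrite -map_comp (eq_map char_set_set_of_seq).
exact: (allP images_steiner).
Qed.

Lemma card_designs L Q : L \in designs -> Q \in L -> #|Q| = 4.
Proof.
case/mapP=> L' tL' -> /mapP[Q' L'Q' ->].
rewrite -count_char_set char_set_set_of_seq.
by apply/eqP/(allP (allP images_size L' tL')).
Qed.

Lemma steiner_designs L : L \in designs -> steiner 4 [set Q in L].
Proof.
move=> dL; apply: steiner_count => [|A [card_A]]; last exact: count_designs.
by apply/allP=> Q LQ; rewrite (card_designs dL LQ).
Qed.

(** No block is repeated in an image, as two equal blocks would share triples;
    so occurrences in all the images together count the images containing Q. *)
Lemma count_mem_designs L (Q : {set 'I_14}) :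
  L \in designs -> #|Q| = 4 -> count_mem Q L <= 1.
Proof.
move=> dL card_Q; have [x Qx] : exists x, x \in Q by apply/card_gt0P; rewrite card_Q.
have card_Qx : #|Q :\ x| = 3 by move: card_Q; rewrite (cardsD1 x) Qx => -[].
apply: leq_trans (eq_leq (count_designs dL card_Qx)).
by apply: sub_count => _ /eqP ->; apply: subD1set.
Qed.

Lemma cover_designs (Q : {set 'I_14}) : #|Q| = 4 ->
  #|[set j : 'I_(size designs) | Q \in nth [::] designs j]| = 5.
Proof.
move=> card_Q; rewrite card_index_flatten => [|L dL]; last exact: count_mem_designs.
rewrite (eq_count (a2 := fun Q' => all2 eqb (char_set Q) (char_set Q'))); last first.
  by move=> Q'; rewrite all2_eqb_char_set.
apply: balanced_char_set card_Q.
rewrite -map_flatten -map_comp (eq_map char_set_set_of_seq).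
exact: images_balanced.
Qed.

Lemma size_designs : size designs = 55.
Proof. by rewrite size_map. Qed.

Theorem corollary7 :
  exists (X : finType) (G B : {set {set X}}),
    is_gdd 4 5 (14 * 720 + 11 * 720) [:: (720, 14); (11 * 720, 1)] G B.
Proof.
pose J : finType := ('I_144 * 'I_(size designs))%type.
have card_J : #|J| = 11 * 720.
  by rewrite card_prod !card_ord size_designs -[55]/(5 * 11) mulnA mulnC.
pose S (l : J) : {set {set 'I_14}} := [set Q in nth [::] designs l.2].
have [||||G [B]] := @gdd_of_steiner_family 'I_14 J 'I_720 4 S.
- by [].
- by rewrite card_J.
- by move=> l; apply: steiner_designs; apply: mem_nth.
- move=> Q card_Q; have -> : [set l | Q \in S l] =
      setX [set: 'I_144] [set j : 'I_(size designs) | Q \in nth [::] designs j].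
    by apply/setP=> -[i j]; rewrite !inE.
  by rewrite cardsX cardsT !card_ord cover_designs.
by rewrite card_J !card_ord => gddB; exists (point 'I_14 J 'I_720), G, B.
Qed.
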